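(* Algorithm monobeam with duplicate elimination, with an admissible heuristic and beam width $k+1$, will always return a solution with cost lower than or equal to the cost of the best solution found by the same algorithm (on the same problem) with beam width $k$, for all $k \ge 1$.
   Context: Search problem. There is a set of states, a start state, a set of goal states, and for each state a set of actions (operators), each leading to a successor state and having a nonnegative cost. The domain does not contain infinite sequences of zero-cost operators. A node is a sequence of actions from the start state; it represents the state at its end, and different nodes may represent the same state. The node ''start'' is the empty sequence. The children of a node are its one-action extensions. $g(n)$ is the total cost of the actions of $n$. A solution is a node representing a goal state; its cost is its $g$-value. The heuristic $h \ge 0$ (cost-to-go estimate of the state represented by a node) is admissible: it never exceeds the cost of any path from that state to a goal state (so $h=0$ on goals). It need not be consistent. $f$-values. $f(n)=g(n)+h(n)$, corrected by pathmax: when a child of a node $n$ is generated and $f(\text{child})<f(n)$, then $f(\text{child})$ is set to $f(n)$. Selection rule. ''The minimum $f$-value node'' of candidates is a node of smallest $f$-value, with ties broken on low $h$-values. Algorithm monobeam with duplicate elimination, with parameters start and width. A beam is an array with slots $1,\dots,\text{width}$, each either empty or containing one node. A closed list, kept throughout the run and initially empty, holds at most one entry per state; an entry is a node $m$ representing that state together with a slot index $m.\text{width}$. Initially solutionCost $=\infty$, beam[1] = start, all other slots are empty. While at least one slot of beam contains a node with $f$-value $<$ solutionCost, do one iteration: (1) Set candidates $=\emptyset$ and let nextBeam have all slots empty. (2) For $c=1,2,\dots,\text{width}$ in this order: (2a) If beam[c] contains a node, then for each child of it (with pathmax applied): if the child is a goal, then, if moreover $f(\text{child})<$ solutionCost,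 store it as the incumbent solution and set solutionCost $= f(\text{child})$; if the child is not a goal, add it to candidates. (2b) (Duplicate elimination.) Set done = false. While candidates is nonempty and done = false: let node be the minimum $f$-value node of candidates (not removed yet) and set node.width $=c$. If node's state has no entry in closed, add node to closed and set done = true. Otherwise let dup be the closed entry for node's state: if node.width $<$ dup.width, update the closed entry to node and set done = true; else if $f(\text{node}) \le f(\text{dup})$, then update the closed entry to node in case node.width $=$ dup.width, and (in either case) set done = true; else remove node from candidates. (2c) If candidates is nonempty, remove its minimum $f$-value node and put it in nextBeam[c]. (3) Set beam = nextBeam. When the loop ends, return the stored incumbent solution.
   Formalization: The width k+1 run is shown to halt and return only if positive action costs are bounded away from 0 (else it may never halt); without this, it finds such a solution and anything returned is one. Actions per state are finite; both widths share one deterministic rule for remaining ties. *)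

(* Defs.v *)
From mathcomp Require Import all_boot all_order all_algebra.
From mathcomp Require Import reals constructive_ereal.

Set Implicit Arguments.
Unset Strict Implicit.
Unset Printing Implicit Defensive.

Import Order.TTheory GRing.Theory Num.Theory.
Local Open Scope ring_scope.

(* Each state has finitely many actions, so that the candidates of the
   algorithm always form a finite set.  The set of states may be infinite.
   The values of [succ] and [cost] at actions outside [acts s] are junk. *)
Record problem (R : realType) := Problem {
  state : eqType;
  action : eqType;
  start : state;
  goal : pred state;
  acts : state -> seq action;
  acts_uniq : forall s, uniq (acts s);
  succ : state -> action -> state;
  cost : state -> action -> R;
  cost_ge0 : forall s a, a \in acts s -> 0 <= cost s a }.

Section Search.
Context (R : realType) (P : problem R).
Implicit Types (s : state P) (p : seq (action P)).

(* Action sequences are stored with the LAST action at the head: [a :: p] is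
   [p] followed by [a]. *)
Fixpoint end_state s p : state P :=
  if p is a :: p' then succ (end_state s p') a else s.

Fixpoint applicable s p : bool :=
  if p is a :: p' then applicable s p' && (a \in acts (end_state s p'))
  else true.

Fixpoint path_cost s p : R :=
  if p is a :: p' then path_cost s p' + cost (end_state s p') a else 0.

Definition node : Type := seq (action P).
Definition node_state (n : node) : state P := end_state (start P) n.
Definition g (n : node) : R := path_cost (start P) n.
Definition children (n : node) : seq node :=
  [seq a :: n | a <- acts (node_state n)].

Definition solution (n : node) : bool :=
  applicable (start P) n && goal (node_state n).

Definition no_infinite_zero_cost_sequence : Prop :=
  ~ exists (s : nat -> state P) (a : nat -> action P), forall i,
      [/\ a i \in acts (s i), s i.+1 = succ (s i) (a i)
        & cost (s i) (a i) = 0].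

(* This holds in particular when there are finitely many states, or when all
   costs are integers. *)
Definition positive_costs_bounded_below : Prop :=
  exists2 d : R, 0 < d &
    forall s a, a \in acts s -> 0 < cost s a -> d <= cost s a.

Definition admissible (h : state P -> R) : Prop :=
  forall s p, applicable s p -> goal (end_state s p) -> h s <= path_cost s p.

Section Monobeam.
Variable h : state P -> R.

(* Pathmax: the corrected value of a child is never below that of its parent,
   hence it is determined by the node. *)
Fixpoint f (n : node) : R :=
  if n is a :: m then Num.max (f m) (g n + h (node_state n))
  else g n + h (node_state n).

(* [sel] is a rule choosing "the" minimum f-value node of a nonempty collection
   of candidates; ties in both f and h are resolved by [sel] in an arbitrary
   but deterministic way, possibly depending on the order of generation. *)
Definition min_f_selection (sel : seq node -> node) : Prop :=
  forall cs : seq node, cs != [::] ->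
    sel cs \in cs /\
    forall m : node, m \in cs ->
      f (sel cs) <= f m /\
      (f (sel cs) = f m -> h (node_state (sel cs)) <= h (node_state m)).

Variable sel : seq node -> node.

(* The pair [(m, c)] is the closed entry [m] with [m.width = c]. *)
Definition closed_list : Type := state P -> option (node * nat).

Definition close (cl : closed_list) (n : node) (c : nat) : closed_list :=
  fun s => if s == node_state n then Some (n, c) else cl s.

(* Only the slots 1, ..., width of a beam are ever read or written. *)
Definition beam_array : Type := nat -> option node.

Definition set_slot (b : beam_array) (c : nat) (n : node) : beam_array :=
  fun i => if i == c then Some n else b i.

Record search_state := SearchState {
  beam : beam_array;
  closed : closed_list;
  incumbent : option node;
  solution_cost : \bar R }.

Record slot_state := SlotState {
  candidates : seq node;
  next_beam : beam_array;
  cur_closed : closed_list;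
  cur_incumbent : option node;
  cur_cost : \bar R }.

Definition generate (t : slot_state) (n : node) : slot_state :=
  let: SlotState cs nb cl inc sc := t in
  if goal (node_state n) then
    if ((f n)%:E < sc)%E then SlotState cs nb cl (Some n) (f n)%:E else t
  else SlotState (rcons cs n) nb cl inc sc.

Definition expand (b : option node) (t : slot_state) : slot_state :=
  if b is Some n then foldl generate t (children n) else t.

(* Duplicate elimination.  Each recursive call removes one candidate, so that
   [size cs] is enough fuel.  When it stops at an accepted node, that node is
   still [sel] of the remaining candidates and is the one taken by [fill]. *)
Fixpoint dedup_rec (fuel c : nat) (cs : seq node) (cl : closed_list) :
    seq node * closed_list :=
  if fuel is fuel'.+1 then
    if cs == [::] then (cs, cl) else
    let n := sel cs in
    if cl (node_state n) is Some (dup, dup_width) then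
      if (c < dup_width)%N then (cs, close cl n c)
      else if f n <= f dup then
        (cs, if c == dup_width then close cl n c else cl)
      else dedup_rec fuel' c (rem n cs) cl
    else (cs, close cl n c)
  else (cs, cl).

Definition dedup (c : nat) (t : slot_state) : slot_state :=
  let: SlotState cs nb cl inc sc := t in
  let: (cs', cl') := dedup_rec (size cs) c cs cl in
  SlotState cs' nb cl' inc sc.

Definition fill (c : nat) (t : slot_state) : slot_state :=
  let: SlotState cs nb cl inc sc := t in
  if cs == [::] then t
  else SlotState (rem (sel cs) cs) (set_slot nb c (sel cs)) cl inc sc.

Definition process_slot (b : beam_array) (t : slot_state) (c : nat) :
    slot_state :=
  fill c (dedup c (expand (b c) t)).

Definition iteration (width : nat) (S : search_state) : search_state :=
  let: SearchState b cl inc sc := S in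
  let: SlotState _ nb cl' inc' sc' :=
    foldl (process_slot b) (SlotState [::] (fun=> None) cl inc sc)
      (iota 1 width) in
  SearchState nb cl' inc' sc'.

Definition continues (width : nat) (S : search_state) : bool :=
  has (fun c => if beam S c is Some n then ((f n)%:E < solution_cost S)%E
                else false)
    (iota 1 width).

Definition init : search_state :=
  SearchState (fun c => if c == 1%N then Some [::] else None) (fun=> None)
    None +oo%E.

(* The state after [i] iterations, or the final state if the loop ends
   earlier. *)
Definition run (width i : nat) : search_state :=
  iter i (fun S => if continues width S then iteration width S else S) init.

Definition found (width : nat) (n : node) : Prop :=
  exists i, incumbent (run width i) = Some n.

(* [None] is returned by a run that ends without any incumbent. *)
Definition returns (width : nat) (r : option node) : Prop :=
  exists i, ~~ continues width (run width i) /\ incumbent (run width i) = r.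

End Monobeam.
End Search.

(* Main.v *)
(* In every iteration slot [k + 1] is processed after slots 1, ..., k and only
   writes closed entries of width [k + 1], which the first [k] slots treat as
   absent, and never replaces a narrower entry.  Hence, while both loops run, the beams of widths [k] and [k + 1]
   agree on slots 1, ..., k, and the wider search has generated every solution
   that the narrower one has.  If the wider search stops first, pathmax shows
   that all descendants of the narrower beam cost at least its incumbent, as
   [f] equals [g] on solutions.  Termination follows from König's lemma:
   a beam node after [i] iterations has [i] actions, and only boundedly long
   action sequences cost less than the incumbent. *)

Require Import Defs.
From mathcomp Require Import all_boot all_order all_algebra.
From mathcomp Require Import reals constructive_ereal boolp.

Set Implicit Arguments.
Unset Strict Implicit.
Unset Printing Implicit Defensive.

Import Order.TTheory GRing.Theory Num.Theory.
Local Open Scope ring_scope.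

(** If every element failed at some index, all would fail at the maximum of these finitely many
    indices, because failure persists at larger indices. *)
Lemma ex_mem_forall_antitone (T : eqType) (l : seq T) (Q : T -> nat -> Prop) :
  (forall x i j, (i <= j)%N -> Q x j -> Q x i) ->
  (forall j, exists2 x, x \in l & Q x j) ->
  exists2 x, x \in l & forall j, Q x j.
Proof.
move=> anti unb; apply: contrapT => none.
suff [j jP] : exists j, forall x, x \in l -> ~ Q x j.
  by have [x xl /(jP x xl)] := unb j.
have {none unb} : forall x, x \in l -> exists j, ~ Q x j.
  by move=> x xl; apply/existsNP => allQ; apply: none; exists x.
elim: l => [|x l IHl] bnd; first by exists 0%N.
have [y yl|j jP] := IHl; first by apply: bnd; rewrite inE yl orbT.
have [i iP] := bnd x (mem_head x l).
exists (maxn i j) => y; rewrite inE => /orP[/eqP->|yl] /anti Qy.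
  by apply: iP; apply: Qy; rewrite leq_maxl.
by apply: (jP y yl); apply: Qy; rewrite leq_maxr.
Qed.

(** * Action sequences and König's lemma *)

Section Paths.
Context (R : realType) (P : problem R).
Implicit Types (s : state P) (p q m : seq (action P)).

Lemma end_state_cat s p q : end_state s (q ++ p) = end_state (end_state s p) q.
Proof. by elim: q => //= a q ->. Qed.

Lemma applicable_cat s p q :
  applicable s (q ++ p) = applicable s p && applicable (end_state s p) q.
Proof.
by elim: q => [|a q IHq] /=; rewrite ?andbT // IHq end_state_cat andbA.
Qed.

Lemma path_cost_cat s p q :
  path_cost s (q ++ p) = path_cost s p + path_cost (end_state s p) q.
Proof.
by elim: q => [|a q IHq] /=; rewrite ?addr0 // IHq end_state_cat addrA.
Qed.

Lemma path_cost_ge0 s p : applicable s p -> 0 <= path_cost s p.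
Proof.
by elim: p => //= a p IHp /andP[/IHp ? ?]; rewrite addr_ge0 ?cost_ge0.
Qed.

Lemma path_cost_catl s p q :
  applicable s (q ++ p) -> path_cost s p <= path_cost s (q ++ p).
Proof.
rewrite applicable_cat path_cost_cat => /andP[_ /path_cost_ge0].
by rewrite lerDl.
Qed.

Definition deep_below (C : R) m : Prop := forall j, exists q,
  [/\ (j <= size q)%N, applicable (start P) (q ++ m) & g (q ++ m) <= C].

(* König's lemma, one step: the finitely many children of a node with
   arbitrarily long cheap extensions cannot all fail to have them. *)
Lemma deep_below_child (C : R) m : deep_below C m ->
  exists2 a, a \in acts (node_state m) & deep_below C (a :: m).
Proof.
move=> deep; apply: ex_mem_forall_antitone => [a i j leij [q [jq qa qC]]|j].
  by exists q; split=> //; apply: leq_trans jq.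
have [q [jq qa qC]] := deep j.+1.
(* Sequences are stored last action first, so the action directly after [m] is the last item of
   [q]. *)
case: (lastP q) jq qa qC => // q' a; rewrite size_rcons ltnS cat_rcons.
move=> jq qa qC; exists a; last by exists q'.
by move: qa; rewrite applicable_cat /= => /andP[/andP[]].
Qed.

(** Otherwise König's lemma yields an infinite path whose prefixes all cost at most [C]. Positive
    costs recur on it forever, each at least [d], so the prefix costs are unbounded. *)
Lemma bounded_cost_bounded_size (C : R) :
  no_infinite_zero_cost_sequence P -> positive_costs_bounded_below P ->
  exists N, forall m, applicable (start P) m -> g m <= C -> (size m < N)%N.
Proof.
move=> no_zero [d d_gt0 dP]; apply: contrapT => unb.
have deep0 : deep_below C [::].
  move=> j; apply: contrapT => none; apply: unb; exists j => m mapp mC.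
  rewrite ltnNge; apply/negP => jm; apply: none.
  by exists m; rewrite cats0.
(* Bundling nodes with their depth property lets choice give a map that can be iterated. *)
pose deep := {m | deep_below C m}.
have /choice[next nextP] : forall x : deep, exists y : deep, exists2 a,
    a \in acts (node_state (sval x)) & sval y = a :: sval x.
  move=> [m mdeep]; have [a am amdeep] := deep_below_child mdeep.
  by exists (exist _ _ amdeep), a.
pose x i := sval (iter i next (exist _ _ deep0)).
have /choice[a aP] : forall i, exists b,
    b \in acts (node_state (x i)) /\ x i.+1 = b :: x i.
  by move=> i; have [b] := nextP (iter i next (exist _ _ deep0)); exists b.
have gS i : g (x i.+1) = g (x i) + cost (node_state (x i)) (a i).
  by have [_ ->] := aP i.
have gC i : g (x i) <= C.
  rewrite /x; case: (iter _ _ _) => m mdeep /=.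
  have [q [_ qa qC]] := mdeep 0%N; apply: le_trans qC.
  exact: path_cost_catl.
have cge0 i : 0 <= cost (node_state (x i)) (a i).
  by rewrite cost_ge0 //; have [] := aP i.
have gle i j : (i <= j)%N -> g (x i) <= g (x j).
  move=> /subnK <-; elim: (j - i)%N => // l IHl.
  by rewrite addSn gS (le_trans IHl) // lerDl.
have [[N NP]|pos] := pselect (exists N, forall i, (N <= i)%N ->
    cost (node_state (x i)) (a i) = 0).
  apply: no_zero; exists (fun i => node_state (x (N + i)%N)).
  exists (fun i => a (N + i)%N) => i; have [am xS] := aP (N + i)%N.
  by split=> //; [rewrite addnS xS | apply: NP; rewrite leq_addr].
have grow K : exists i, d *+ K <= g (x i).
  elim: K => [|K [i iK]]; first by exists 0%N; rewrite /x /= mulr0n.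
  have [j [leij cj]] : exists j, (i <= j)%N /\
      cost (node_state (x j)) (a j) <> 0.
    apply: contrapT => none; apply: pos; exists i => j leij.
    by apply: contrapT => cj; apply: none; exists j.
  exists j.+1; rewrite gS mulrSr lerD ?(le_trans iK) ?gle //.
  apply: dP; first by have [] := aP j.
  by rewrite lt_neqAle cge0 andbT eq_sym; apply/eqP.
(* The Archimedean bound exceeds [C / d], so this many costs of [d] exceed [C]. *)
have [i] := grow (Num.bound (C / d)).
apply/negP; rewrite -ltNge (le_lt_trans (gC i)) //.
rewrite -mulr_natl -ltr_pdivrMr //.
by rewrite archi_boundP // divr_ge0 ?(ltW d_gt0) // (gC 0%N).
Qed.

End Paths.

(** * Pathmax values against solution costs *)

Section Evaluation.
Context (R : realType) (P : problem R) (h : state P -> R).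
Implicit Types m n : node P.

Lemma f_cons a m : f h m <= f h (a :: m).
Proof. by rewrite /= le_max lexx. Qed.

Lemma g_le_f n : (forall s, 0 <= h s) -> g n <= f h n.
Proof.
by move=> h_ge0; case: n => [|a m]; rewrite /= ?le_max lerDl h_ge0 ?orbT.
Qed.

Lemma g_plus_h_le_solution m q : admissible h -> solution (q ++ m) ->
  g m + h (node_state m) <= g (q ++ m).
Proof.
move=> h_adm /andP[]; rewrite applicable_cat /node_state end_state_cat.
by move=> /andP[_ /h_adm hq] /hq; rewrite /g path_cost_cat lerD2l.
Qed.

(** Pathmax takes a maximum over the prefixes of [m], and each of them is also a prefix of the
    solution; the induction moves the last action of [m] into [q]. *)
Lemma f_le_solution m q : admissible h -> solution (q ++ m) ->
  f h m <= g (q ++ m).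
Proof.
move=> h_adm; elim: m q => [|a m IHm] q sol_qm.
  exact: g_plus_h_le_solution.
have ghm := g_plus_h_le_solution h_adm sol_qm.
by rewrite [f _ _]/= ge_max ghm andbT -cat_rcons IHm // cat_rcons.
Qed.

Lemma f_solution n : (forall s, 0 <= h s) -> admissible h -> solution n ->
  f h n = g n.
Proof.
move=> h_ge0 h_adm sol_n; apply: le_anti.
by rewrite g_le_f // (@f_le_solution n [::]).
Qed.

End Evaluation.

Section Runs.
Context (R : realType) (P : problem R) (h : state P -> R).
Context (sel : seq (node P) -> node P) (sel_min : min_f_selection h sel).
Implicit Types (n m : node P) (cs : seq (node P)) (b : beam_array P).
Implicit Types (cl : closed_list P) (t : slot_state P) (S : search_state P).

(** * Invariants of one iteration *)

Section Invariant.
Context (Q : node P -> Prop) (J : option (node P) -> \bar R -> Prop).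

(** [Q] is meant for the generated nodes and [J] for the incumbent with its cost; the facts about
    single runs below arise by choosing these two. *)
Definition slot_invariant t : Prop :=
  [/\ forall m, m \in candidates t -> Q m,
      forall c m, next_beam t c = Some m -> Q m
    & J (cur_incumbent t) (cur_cost t)].

Hypothesis update : forall inc sc m, J inc sc -> Q m -> goal (node_state m) ->
  ((f h m)%:E < sc)%E -> J (Some m) (f h m)%:E.

Lemma generate_invariant t n :
  slot_invariant t -> Q n -> slot_invariant (generate h t n).
Proof.
case: t => cs nb cl inc sc [/= csP nbP incP] Qn.
case: ifPn => [goal_n|_].
  by case: ifP => [fsc|_]; split=> //=; apply: (update incP).
split=> //= m; rewrite mem_rcons inE => /orP[/eqP->|/csP] //.
Qed.

Lemma expand_invariant t (o : option (node P)) :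
  (forall m a, o = Some m -> a \in acts (node_state m) -> Q (a :: m)) ->
  slot_invariant t -> slot_invariant (Defs.expand h o t).
Proof.
case: o => [n|] //= childP.
have {childP} : forall m, m \in children n -> Q m.
  by move=> _ /mapP[a an ->]; apply: childP.
elim: (children n) t => //= m ms IHms t msP tP; apply: IHms.
  by move=> m' m'P; apply: msP; rewrite inE m'P orbT.
by apply: generate_invariant => //; apply: msP; rewrite mem_head.
Qed.

Lemma mem_dedup_rec fuel c cs cl m :
  m \in (dedup_rec h sel fuel c cs cl).1 -> m \in cs.
Proof.
elim: fuel cs cl => [|fuel IH] cs cl //=; case: ifP => // _.
case: (cl (node_state (sel cs))) => [[dup w]|] //.
by case: ifP => // _; case: ifP => // _ /IH /mem_rem.
Qed.

Lemma process_slot_invariant b t c :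
  (forall m a, b c = Some m -> a \in acts (node_state m) -> Q (a :: m)) ->
  slot_invariant t -> slot_invariant (process_slot h sel b t c).
Proof.
move=> /expand_invariant /[apply]; rewrite /process_slot.
case: (Defs.expand _ _ _) => cs nb cl inc sc [/= csP nbP incP].
case: (dedup_rec _ _ _ _ _ _) (@mem_dedup_rec (size cs) c cs cl).
move=> cs' cl' /= cs'_sub; case: eqP => [->|/eqP cs'_n0] //.
have [sel_cs' _] := sel_min cs'_n0.
split=> //= [m /mem_rem /cs'_sub /csP //|i m].
rewrite /set_slot; case: eqP => [_ [<-]|_ /nbP //].
exact/csP/cs'_sub.
Qed.

Lemma iteration_invariant width S :
  (forall c m a, c \in iota 1 width -> beam S c = Some m ->
     a \in acts (node_state m) -> Q (a :: m)) ->
  J (incumbent S) (solution_cost S) ->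
  (forall c m, beam (iteration h sel width S) c = Some m -> Q m) /\
  J (incumbent (iteration h sel width S))
    (solution_cost (iteration h sel width S)).
Proof.
case: S => b cl inc sc /= bP incP.
set t0 := SlotState _ _ _ _ _.
have : slot_invariant t0 by [].
elim: (iota 1 width) bP t0 => [_ [cs nb cl' inc' sc' [] //]|c l IHl bP t0 t0P].
apply: IHl => [c' m a c'l|]; first by apply: bP; rewrite inE c'l orbT.
by apply: process_slot_invariant t0P => m a; apply: bP; rewrite mem_head.
Qed.

End Invariant.

(** * Coupling of the searches of widths [k] and [k.+1] *)

Definition restrict_closed k cl : closed_list P := fun s =>
  if cl s is Some (m, w) then if (w <= k)%N then Some (m, w) else None
  else None.

Lemma restrict_close_le k cl cl' n c : (c <= k)%N ->
  cl =1 restrict_closed k cl' ->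
  close cl n c =1 restrict_closed k (close cl' n c).
Proof.
move=> ck clP s; rewrite /close /restrict_closed.
by case: ifP; rewrite ?ck ?clP.
Qed.

Lemma restrict_close_gt k cl n c : (k < c)%N ->
  restrict_closed k cl (node_state n) = None ->
  restrict_closed k (close cl n c) =1 restrict_closed k cl.
Proof.
move=> kc cl_n s; rewrite [LHS]/restrict_closed /close.
by case: eqP => // ->; rewrite leqNgt kc.
Qed.

(* An entry wider than [k] is always overridden by a slot [c <= k], exactly as
   if it were absent. *)
Lemma dedup_rec_restrict_le k fuel c cs cl cl' : (c <= k)%N ->
  cl =1 restrict_closed k cl' ->
  (dedup_rec h sel fuel c cs cl).1 = (dedup_rec h sel fuel c cs cl').1 /\
  (dedup_rec h sel fuel c cs cl).2 =1
    restrict_closed k (dedup_rec h sel fuel c cs cl').2.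
Proof.
move=> ck; elim: fuel cs cl cl' => [|fuel IH] cs cl cl' clP //=.
have closeP := restrict_close_le (sel cs) ck clP.
case: ifP => // _; rewrite clP /restrict_closed.
case: (cl' (node_state (sel cs))) => [[dup w]|]; last by split.
have [wk|kw] := leqP w k; last by rewrite (leq_ltn_trans ck kw).
case: ifP => // _; case: ifP => [_|_]; last exact: IH.
by split=> //=; case: ifP.
Qed.

(** Slot [c] writes only where there is no entry or one of width at least [c]; as [k < c], the old
    and the new entry are both hidden by the restriction. *)
Lemma dedup_rec_restrict_gt k fuel c cs cl : (k < c)%N ->
  restrict_closed k (dedup_rec h sel fuel c cs cl).2 =1 restrict_closed k cl.
Proof.
move=> kc; elim: fuel cs => [|fuel IH] cs //=; case: ifP => // _.
have closeP := @restrict_close_gt k cl (sel cs) c kc.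
move: closeP; rewrite {1}/restrict_closed.
case: (cl (node_state (sel cs))) => [[dup w]|] closeP; last exact: closeP.
have [cw|wc] := ltnP c w.
  by apply: closeP; rewrite leqNgt (ltn_trans kc cw).
case: ifP => [_|_]; last exact: IH.
by case: eqP => // cw; apply: closeP; rewrite leqNgt -cw kc.
Qed.

(** Candidates are left out because they agree only until the wider search processes its extra slot.
    Costs need only be ordered, since that search may find further goals. *)
Definition slot_coupled k t t' : Prop :=
  [/\ forall c, (c <= k)%N -> next_beam t c = next_beam t' c,
      cur_closed t =1 restrict_closed k (cur_closed t')
    & (cur_cost t' <= cur_cost t)%E].

Lemma expand_coupled k o t t' :
  candidates t = candidates t' -> slot_coupled k t t' ->
  candidates (Defs.expand h o t) = candidates (Defs.expand h o t') /\
  slot_coupled k (Defs.expand h o t) (Defs.expand h o t').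
Proof.
case: o => [n|] //=; elim: (children n) t t' => //= m ms IHms.
move=> [cs nb cl inc sc] [cs' nb' cl' inc' sc'] /= <- [/= nbP clP scP].
apply: IHms; first by do 3?case: ifP.
case: ifP => // _; case: ltP => fsc; case: ltP => fsc'; split=> //=.
by apply: ltW; apply: lt_le_trans scP.
Qed.

Lemma process_slot_coupled k b b' c t t' : (c <= k)%N -> b c = b' c ->
  candidates t = candidates t' -> slot_coupled k t t' ->
  candidates (process_slot h sel b t c) =
    candidates (process_slot h sel b' t' c) /\
  slot_coupled k (process_slot h sel b t c) (process_slot h sel b' t' c).
Proof.
rewrite /process_slot => ck <- /expand_coupled /[apply] /(_ (b c)).
case: (Defs.expand _ _ t) (Defs.expand _ _ t') => cs nb cl inc sc.
move=> [cs' nb' cl' inc' sc'] [/= <- [/= nbP clP scP]].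
have [] := @dedup_rec_restrict_le k (size cs) c cs cl cl' ck clP.
case: (dedup_rec _ _ _ _ _ cl) (dedup_rec _ _ _ _ _ cl') => cs1 cl1.
move=> [_ cl2] /= <- cl12; case: ifP => // _; split=> //=; split=> //= i ik.
by rewrite /set_slot nbP.
Qed.

Lemma expand_frame o t :
  next_beam (Defs.expand h o t) = next_beam t /\
  cur_closed (Defs.expand h o t) = cur_closed t.
Proof.
case: o => [n|] //=; elim: (children n) t => //= m ms IHms t.
have [-> ->] := IHms (generate h t m).
by case: t => cs nb cl inc sc /=; do 2?case: ifP.
Qed.

Lemma process_slot_cost_le b t c :
  (cur_cost (process_slot h sel b t c) <= cur_cost t)%E.
Proof.
suff [] : slot_invariant (fun=> True) (fun _ sc => sc <= cur_cost t)%E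
  (process_slot h sel b t c) by [].
apply: process_slot_invariant => //.
by move=> _ sc m sc_le _ _ /ltW fsc; apply: le_trans sc_le.
Qed.

(** The narrower search stands still here: the extra slot changes only a beam slot beyond [k] and
    hidden closed entries, and can only lower the cost. *)
Lemma process_slot_coupled_gt k b c t t' : (k < c)%N ->
  slot_coupled k t t' -> slot_coupled k t (process_slot h sel b t' c).
Proof.
move=> kc [nbP clP scP].
have := le_trans (process_slot_cost_le b t' c) scP.
move: nbP clP; have [<- <-] := expand_frame (b c) t'.
rewrite /process_slot; case: (Defs.expand _ _ t') => cs nb cl inc sc /=.
move=> nbP clP; have := @dedup_rec_restrict_gt k (size cs) c cs cl kc.
case: (dedup_rec _ _ _ _ _ _) => cs1 cl1 /= cl1P scP'.
have clP1 : cur_closed t =1 restrict_closed k cl1 by move=> s; rewrite cl1P clP.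
move: scP'; case: ifP => _ scP'; split=> //= i ik.
by rewrite /set_slot ltn_eqF ?nbP // (leq_ltn_trans ik kc).
Qed.

Definition coupled k S S' : Prop :=
  [/\ forall c, (c <= k)%N -> beam S c = beam S' c,
      Defs.closed S =1 restrict_closed k (Defs.closed S')
    & (solution_cost S' <= solution_cost S)%E].

Lemma iteration_coupled k S S' : coupled k S S' ->
  coupled k (iteration h sel k S) (iteration h sel k.+1 S').
Proof.
case: S S' => b cl inc sc [b' cl' inc' sc'] [bP clP scP].
(* Splitting off the last slot leaves two folds over the same slots. *)
rewrite /iteration; have -> : iota 1 k.+1 = rcons (iota 1 k) k.+1.
  by rewrite -(addn1 k) iotaD -cats1 (addnC 1%N).
rewrite foldl_rcons.
set t0 := SlotState _ _ _ _ _; set t0' := SlotState _ _ _ _ _.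
have : slot_coupled k t0 t0' by [].
have : candidates t0 = candidates t0' by [].
have : all (fun c => c <= k)%N (iota 1 k).
  by apply/allP => c; rewrite mem_iota add1n ltnS => /andP[].
elim: (iota 1 k) (t0) (t0') => [|c l IHl] {}t0 {}t0' /=.
  move=> _ _ /(process_slot_coupled_gt b' (ltnSn k)).
  by case: t0 (process_slot _ _ _ _ _) => ? ? ? ? ? [].
move=> /andP[ck lk] cs0 t0P.
by have [] := process_slot_coupled ck (bP c ck) cs0 t0P; apply: IHl.
Qed.

(** * Costs along whole runs *)

Lemma iteration_cost_le width S :
  (solution_cost (iteration h sel width S) <= solution_cost S)%E.
Proof.
have [] // := @iteration_invariant (fun=> True)
  (fun _ sc => sc <= solution_cost S)%E _ width S.
by move=> _ sc m sc_le _ _ /ltW fsc; apply: le_trans sc_le.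
Qed.

(* By pathmax, the run from [S] can no longer find anything cheaper than
   [c]. *)
Definition cost_bounded_below width c S : Prop :=
  (c <= solution_cost S)%E /\
  forall i m, i \in iota 1 width -> beam S i = Some m -> (c <= (f h m)%:E)%E.

Lemma iteration_bounded_below width c S :
  cost_bounded_below width c S ->
  cost_bounded_below width c (iteration h sel width S).
Proof.
move=> [c_sc c_f].
have [] // := @iteration_invariant (fun m => c <= (f h m)%:E)%E
  (fun _ sc => c <= sc)%E _ width S.
- move=> i m a ik /(c_f _ _ ik) /le_trans-> //.
  by rewrite lee_fin f_cons.
- by move=> bP scP; split=> // i m _; apply: bP.
Qed.

Lemma stopped_bounded_below width S : ~~ continues h width S ->
  cost_bounded_below width (solution_cost S) S.
Proof.
move=> /hasPn stop; split=> // i m /stop + im; rewrite im.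
by rewrite -leNgt.
Qed.

Lemma run_cost_le width i j : (i <= j)%N ->
  (solution_cost (run h sel width j) <= solution_cost (run h sel width i))%E.
Proof.
move=> /subnK <-; elim: (j - i)%N => //= l; apply: le_trans.
by case: ifP => // _; apply: iteration_cost_le.
Qed.

Lemma run_stopped width i j : (i <= j)%N ->
  ~~ continues h width (run h sel width i) ->
  run h sel width j = run h sel width i.
Proof.
by move=> /subnK <- /negPf stop; elim: (j - i)%N => //= l ->; rewrite stop.
Qed.

(* The alternative records that one of the two runs has stopped. *)
Lemma run_coupled k i :
  let X := run h sel k i in let Y := run h sel k.+1 i in
  coupled k X Y \/ cost_bounded_below k (solution_cost Y) X.
Proof.
elim: i => [|i]; first by left; split.
rewrite /=; set X := run h sel k i; set Y := run h sel k.+1 i.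
(* The second alternative persists, as the cost of the wider run never rises. *)
have bounded : cost_bounded_below k (solution_cost Y) X ->
    cost_bounded_below k
      (solution_cost (if continues h k.+1 Y then iteration h sel k.+1 Y else Y))
      (if continues h k X then iteration h sel k X else X).
  move=> XY.
  have [] : cost_bounded_below k (solution_cost Y)
      (if continues h k X then iteration h sel k X else X).
    by case: ifP => // _; apply: iteration_bounded_below.
  have YY : (solution_cost
      (if continues h k.+1 Y then iteration h sel k.+1 Y else Y) <=
      solution_cost Y)%E.
    by case: ifP => // _; apply: iteration_cost_le.
  move=> scP fP; split; first exact: le_trans scP.
  by move=> j m jk jm; apply: le_trans YY (fP j m jk jm).
case=> [XY|/bounded]; last by right.
have [bXY _ scXY] := XY.
have [contX|stopX] := boolP (continues h k X); last first.
  (* The narrower run has stopped: its beam is bounded by its own cost, hence by the smaller cost of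
     the wider run. *)
  right; move: bounded; rewrite (negPf stopX); apply.
  have [_ fX] := stopped_bounded_below stopX.
  by split=> // j m jk /(fX _ _ jk); apply: le_trans.
have [contY|stopY] := boolP (continues h k.+1 Y).
  by left; apply: iteration_coupled.
(* The wider run has stopped: its cost bounds its own beam, which contains the narrower one. *)
right; move: bounded; rewrite contX (negPf stopY); apply.
split=> // j m; rewrite mem_iota add1n ltnS => /andP[j1 jk].
rewrite bXY //; have [_] := stopped_bounded_below stopY; apply.
by rewrite mem_iota j1 add1n ltnS (leq_trans jk).
Qed.

Lemma run_cost_width k i :
  (solution_cost (run h sel k.+1 i) <= solution_cost (run h sel k i))%E.
Proof. by have [[]|[]] := run_coupled k i. Qed.

(** * Incumbents and termination *)

Definition incumbent_ok (inc : option (node P)) (sc : \bar R) : Prop :=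
  if inc is Some m then solution m /\ sc = (f h m)%:E else sc = +oo%E.

Lemma run_incumbent_ok width i :
  incumbent_ok (incumbent (run h sel width i))
    (solution_cost (run h sel width i)).
Proof.
suff [] : (forall c m, beam (run h sel width i) c = Some m ->
    applicable (start P) m) /\
  incumbent_ok (incumbent (run h sel width i))
    (solution_cost (run h sel width i)) by [].
elim: i => [|i [app_i inc_i]] /=.
  by split=> // c m; case: ifP => // _ [<-].
case: ifP => // _; apply: iteration_invariant => //.
- by move=> _ _ m _ app_m goal_m _; split=> //; apply/andP.
- by move=> c m a _ /app_i /= -> .
Qed.

(** The loop must still be running: a stopped run keeps its beam while [i] grows. *)
Lemma run_beam_size width i : continues h width (run h sel width i) ->
  exists m, [/\ applicable (start P) m, size m = i
    & ((f h m)%:E < solution_cost (run h sel width i))%E].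
Proof.
suff beamP : continues h width (run h sel width i) ->
    forall c m, beam (run h sel width i) c = Some m ->
    applicable (start P) m /\ size m = i.
  move=> cont; have /hasP[c _] := cont.
  by case E: (beam _ c) => [m|] // fm; have [? ?] := beamP cont c m E; exists m.
elim: i => [_ c m /=|i IHi]; first by case: ifP => // _ [<-].
have [cont|stop] := boolP (continues h width (run h sel width i)); last first.
  by rewrite (run_stopped (leqnSn i) stop) (negPf stop).
move=> _; rewrite /= cont.
have [] // := @iteration_invariant (fun m => applicable (start P) m /\
  size m = i.+1) (fun _ _ => True) _ width (run h sel width i).
by move=> c m a _ /(IHi cont)[/= -> ->] ->.
Qed.

Lemma run_stops width i (C : R) :
  no_infinite_zero_cost_sequence P -> positive_costs_bounded_below P ->
  (forall s, 0 <= h s) -> (solution_cost (run h sel width i) <= C%:E)%E ->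
  exists j, ~~ continues h width (run h sel width j).
Proof.
move=> no_zero pos h_ge0 scC.
have [N NP] := bounded_cost_bounded_size C no_zero pos.
(* From [i] on the cost is at most [C]; from [N] on a running loop would hold a node too long to
   cost that little. *)
exists (maxn i N); apply/negP => /run_beam_size[m [app_m size_m f_m]].
have : (size m < N)%N.
  apply: NP => //; rewrite -lee_fin (le_trans _ scC) //.
  apply: le_trans (run_cost_le width (leq_maxl i N)).
  by apply: le_trans (ltW f_m); rewrite lee_fin g_le_f.
by rewrite size_m ltnNge leq_maxr.
Qed.

End Runs.

(** Here [n] may be any incumbent of the narrower run, final or not. The conclusions separate
    correctness of a returned result, discovery without termination, and termination, which alone
    assumes a lower bound on positive costs. *)
Theorem theorem3 (R : realType) (P : problem R) (h : state P -> R)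
    (sel : seq (node P) -> node P) (k : nat)
    (no_zero : no_infinite_zero_cost_sequence P)
    (h_ge0 : forall s : state P, 0 <= h s)
    (h_adm : admissible h)
    (sel_min : min_f_selection h sel)
    (k_ge1 : (1 <= k)%N)
    (n : node P) (found_k : found h sel k n) :
  [/\ (forall r : option (node P), returns h sel k.+1 r ->
         exists m : node P, [/\ r = Some m, solution m & g m <= g n]),
      (exists m : node P, [/\ found h sel k.+1 m, solution m & g m <= g n])
    & (positive_costs_bounded_below P ->
         exists m : node P,
           [/\ returns h sel k.+1 (Some m), solution m & g m <= g n])].
Proof.
have [i0 inc_n] := found_k.
have := run_incumbent_ok sel_min k i0; rewrite inc_n => -[sol_n cost_n].
have better i m : incumbent (run h sel k.+1 i) = Some m ->
    (solution_cost (run h sel k.+1 i) <= (f h n)%:E)%E ->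
    solution m /\ g m <= g n.
  move=> inc_m; have := run_incumbent_ok sel_min k.+1 i.
  rewrite inc_m => -[sol_m ->]; rewrite lee_fin.
  by rewrite (f_solution h_ge0 h_adm sol_m) (f_solution h_ge0 h_adm sol_n).
have some i : (solution_cost (run h sel k.+1 i) <= (f h n)%:E)%E ->
    exists m, incumbent (run h sel k.+1 i) = Some m.
  have := run_incumbent_ok sel_min k.+1 i.
  by case: incumbent => [m|/= ->] //; exists m.
have cost_i0 : (solution_cost (run h sel k.+1 i0) <= (f h n)%:E)%E.
  by rewrite -cost_n run_cost_width.
have ret r : returns h sel k.+1 r ->
    exists m : node P, [/\ r = Some m, solution m & g m <= g n].
  move=> [j [stop <-]].
  have cost_j : (solution_cost (run h sel k.+1 j) <= (f h n)%:E)%E.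
    have [ij|/ltnW ji] := leqP i0 j.
      by apply: le_trans cost_i0; apply: run_cost_le.
    (* A run that stopped before [i0] is still in the same state at [i0]. *)
    by rewrite -(run_stopped ji stop).
  have [m inc_m] := some j cost_j; have [sol_m gm] := better j m inc_m cost_j.
  by exists m.
split=> //.
  have [m inc_m] := some i0 cost_i0.
  have [sol_m gm] := better i0 m inc_m cost_i0.
  by exists m; split=> //; exists i0.
move=> pos; have [j stop] := run_stops sel_min no_zero pos h_ge0 cost_i0.
have ret_j : returns h sel k.+1 (incumbent (run h sel k.+1 j)) by exists j.
have [m [inc_m sol_m gm]] := ret _ ret_j.
by exists m; split=> //; rewrite -inc_m.
Qed.
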